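(* For all integers $k\ge 3$, $$\sup_{f\in\mathbb{STEP}}\mathbb E|X_f-Y_f|^{k}=\sup_{(X,Y)\in\mathcal C_{\mathcal I}}\mathbb E|X-Y|^{k}.$$
   Context: A pair $(X,Y)$ of random variables on a common probability space $(\Omega,\mathcal F,\mathbb P)$ is called coherent if there exist an event $A\in\mathcal F$ and sub-$\sigma$-fields $\mathcal G,\mathcal H\subset\mathcal F$ such that $X=\mathbb P(A|\mathcal G)$ and $Y=\mathbb P(A|\mathcal H)$. $\mathcal C_{\mathcal I}$ denotes the family of all coherent pairs $(X,Y)$ (over all probability spaces, events and sub-$\sigma$-fields) with $X$ and $Y$ independent. $\mathbb{STEP}$ is the set of all weakly decreasing step functions $f:[0,1]\to[0,1]$ taking finitely many different values. For $f\in\mathbb{STEP}$ the (generalised) Ferrer diagram is $F_f=\{(u,v)\in[0,1]^2: v<f(u)\}$. Let $I=[0,1]^2$ with the completed product Lebesgue measure $\lambda\otimes\lambda$ as probability space, where $\lambda$ is one-dimensional Lebesgue measure. The associated random variables $X_f,Y_f$ on $I$ are $X_f(u,v)=\mathbf x_f(u)$ and $Y_f(u,v)=\mathbf y_f(v)$, where $$\mathbf x_f(u)=\lambda\big(\{v\in[0,1]:(u,v)\in F_f\setminus\mathrm{bd}(F_f)\}\big),\qquad \mathbf y_f(v)=\lambda\big(\{u\in[0,1]:(u,v)\in F_f\setminus\mathrm{bd}(F_f)\}\big),$$ and $\mathrm{bd}(F_f)$ is the topological boundary of $F_f$ in $I$. *)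

(* Defs.v *)
From HB Require Import structures.
From mathcomp Require Import all_boot all_order all_algebra.
From mathcomp Require Import all_classical all_reals all_analysis.

Set Implicit Arguments.
Unset Strict Implicit.
Unset Printing Implicit Defensive.

Import Order.TTheory GRing.Theory Num.Theory.
Import numFieldNormedType.Exports.

Local Open Scope classical_set_scope.
Local Open Scope ring_scope.

Section coherence.
Context d (T : measurableType d) (R : realType) (P : probability T R).

Definition sub_sigma_field (G : set (set T)) :=
  sigma_algebra setT G /\ G `<=` measurable.

(* X = P(A | G) means that X is a version of this conditional probability. *)
Definition is_cond_prob (A : set T) (G : set (set T)) (X : {RV P >-> R}) :=
  [/\ g_sigma_algebra_preimage X `<=` G,
      P.-integrable setT (EFin \o X) &
      forall B, G B -> (\int[P]_(w in B) (X w)%:E = P (A `&` B))%E].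

Definition coherent (X Y : {RV P >-> R}) :=
  exists (A : set T) (G H : set (set T)),
    [/\ measurable A, sub_sigma_field G, sub_sigma_field H,
        is_cond_prob A G X & is_cond_prob A H Y].

Definition independent (X Y : {RV P >-> R}) :=
  forall B C : set R, measurable B -> measurable C ->
    (P (X @^-1` B `&` Y @^-1` C) = P (X @^-1` B) * P (Y @^-1` C))%E.

End coherence.

Definition coherent_indep_moments (R : realType) (k : nat) : set (\bar R) :=
  [set e | exists (d : measure_display) (T : measurableType d)
                  (P : probability T R) (X Y : {RV P >-> R}),
     [/\ coherent X Y, independent X Y &
         e = ('E_P[fun w => (`|X w - Y w| ^+ k)%R])%E]].
Arguments coherent_indep_moments : clear implicits.

(* The boundary of B relative to the subspace A; points outside A are isolated
   in [subspace A], hence this is the usual one when B `<=` A. *)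
Definition boundary_in (T : topologicalType) (A B : set T) : set T :=
  closure (B : set (subspace A)) `\` interior (B : set (subspace A)).

Section ferrer.
Context (R : realType).

Definition unit_square : set (R * R) := `[0, 1]%classic `*` `[0, 1]%classic.

(* A function on [0, 1] is represented by a function on R whose values outside
   [0, 1] play no role. *)
Definition STEP : set (R -> R) :=
  [set f | [/\ {homo f : u / u \in `[0, 1]},
               {in `[0, 1] &, {homo f : u v /~ u <= v}} &
               finite_set (f @` `[0, 1])]].

Definition ferrer (f : R -> R) : set (R * R) :=
  unit_square `&` [set p | p.2 < f p.1].

Definition ferrer_int (f : R -> R) : set (R * R) :=
  ferrer f `\` boundary_in unit_square (ferrer f).

Definition ferrer_x (f : R -> R) (u : R) : R :=
  fine (lebesgue_measure [set v | v \in `[0, 1] /\ ferrer_int f (u, v)]).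

Definition ferrer_y (f : R -> R) (v : R) : R :=
  fine (lebesgue_measure [set u | u \in `[0, 1] /\ ferrer_int f (u, v)]).

Definition ferrer_X (f : R -> R) (p : R * R) : R := ferrer_x f p.1.

Definition ferrer_Y (f : R -> R) (p : R * R) : R := ferrer_y f p.2.

Definition lebesgue2 :
    {measure set (measurableTypeR R * measurableTypeR R)%type -> \bar R} :=
  (@lebesgue_measure R \x @lebesgue_measure R)%E.

(* Caratheodory-measurable sets of the plane; as lebesgue2 is sigma-finite,
   they form the completion of the Borel sigma-field with respect to it. *)
Definition lebesgue_plane : measurableType _ :=
  caratheodory_type (lebesgue2^*)%mu.

Lemma measurable_unit_square : measurable (unit_square : set lebesgue_plane).
Proof.
by apply: caratheodory_measurable_mu_ext; apply: measurableX;
  exact: measurable_itv.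
Qed.

(* The completed product Lebesgue measure on the unit square, as a measure on
   the plane that vanishes outside the unit square. *)
Definition unit_square_prob : set lebesgue_plane -> \bar R :=
  mrestr (@completed_measure_extension _ _ _ lebesgue2) measurable_unit_square.

HB.instance Definition _ := Measure.on unit_square_prob.

Lemma unit_square_prob_setT : unit_square_prob setT = 1%E.
Proof.
rewrite /unit_square_prob /mrestr setTI /completed_measure_extension.
rewrite measurable_mu_extE; last by apply: measurableX; exact: measurable_itv.
have /= -> := @product_measure1E _ _ _ _ _ (@lebesgue_measure R)
  (@lebesgue_measure R) _ _ (measurable_itv `[0, 1]) (measurable_itv `[0, 1]).
by rewrite lebesgue_measure_itv /= lte_fin ltr01 oppr0 adde0 mule1.
Qed.

HB.instance Definition _ :=
  Measure_isProbability.Build _ _ _ unit_square_prob unit_square_prob_setT.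

End ferrer.

Arguments STEP : clear implicits.
Arguments unit_square_prob : clear implicits.

(* Main.v *)
From HB Require Import structures.
Require Import Defs.
From mathcomp Require Import all_boot all_order all_algebra.
From mathcomp Require Import all_classical all_reals all_analysis.
From mathcomp Require Import measurable_realfun lra.
Set Implicit Arguments.
Unset Strict Implicit.
Unset Printing Implicit Defensive.
Import Order.TTheory GRing.Theory Num.Theory.
Import numFieldNormedType.Exports.
Local Open Scope classical_set_scope.
Local Open Scope ring_scope.

(* For [f] in STEP, the pair of row and column heights of its Ferrer diagram F
   is the pair of conditional probabilities of F given the two coordinates, so
   it is coherent and independent.

   Conversely, let (X, Y) be coherent and independent. Binning the values of X
   and Y changes the moment by at most 2k/N and yields masses p_i, q_j, averages
   x_i, y_j and a matrix a_ij = P(A, X in bin i, Y in bin j) with row sums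
   p_i x_i and column sums q_j y_j; independence gives a_ij <= p_i q_j. Let f be
   the decreasing step function with value x_i on a block of length p_i, and g
   its conjugate. The mass of A over the s-part of the highest values of Y is at
   most sum_i p_i min(x_i, s), which is the integral of g over [0, s], with
   equality for s = 1. Hence Y is below g in the convex order, and
   E|c - Y|^k <= E|c - g|^k for every c; integrating over c = f gives the bound. *)

(** * Tangent inequalities for powers and summation by parts *)

Section algebra.
Variable R : realFieldType.
Implicit Types (p q x y d : nat -> R).

Definition cum p (n : nat) : R := \sum_(i < n) p i.

Lemma cumS p n : cum p n.+1 = cum p n + p n.
Proof. by rewrite /cum big_ord_recr. Qed.

Lemma cum0 p : cum p 0 = 0.
Proof. by rewrite /cum big_ord0. Qed.

Lemma le_cum p m n : (forall i, 0 <= p i) -> (m <= n)%N -> cum p m <= cum p n.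
Proof.
move=> p0; elim: n => [|n IH]; first by rewrite leqn0 => /eqP ->.
rewrite leq_eqVlt => /predU1P[-> //|]; rewrite ltnS => /IH /le_trans; apply.
by rewrite cumS lerDl.
Qed.

Lemma cum_ge0 p n : (forall i, 0 <= p i) -> 0 <= cum p n.
Proof. by move=> p0; rewrite -(cum0 p) le_cum. Qed.

(* The derivative of [fun t => `|t| ^+ k.+2]. *)
Definition slope (k : nat) (t : R) : R := k.+2%:R * (t * `|t| ^+ k).

(** Convexity of the power on the half-line, by induction: the previous case multiplied by [b]
    exceeds the next tangent line by exactly [k.+1%:R * a ^+ k * (b - a) ^+ 2]. *)
Lemma exprn_bernoulli (k : nat) (a b : R) : 0 <= a -> 0 <= b ->
  a ^+ k.+1 + k.+1%:R * a ^+ k * (b - a) <= b ^+ k.+1.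
Proof.
move=> a0 b0; elim: k => [|k IH]; first by rewrite !expr1 expr0 !mul1r; lra.
have {IH} := ler_wpM2r b0 IH; rewrite -exprSr => /(le_trans _); apply.
have ak : 0 <= a ^+ k by rewrite exprn_ge0.
rewrite !(exprS a) -subr_ge0.
set z := a ^+ k in ak *.
have -> : (a * z + k.+1%:R * z * (b - a)) * b
   - (a * (a * z) + k.+2%:R * (a * z) * (b - a))
   = k.+1%:R * z * (b - a) ^+ 2.
  by rewrite -[k.+2]addn1 -[k.+1]addn1 !natrD; lra.
by rewrite mulr_ge0 ?sqr_ge0// mulr_ge0.
Qed.

(** Reduces to the half-line at [|t|] and [|s|], because [t * s] is at most [|t| * |s|] while
    [t * t] equals [|t| ^+ 2]. *)
Lemma slope_tangent (k : nat) (s t : R) :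
  `|t| ^+ k.+2 + slope k t * (s - t) <= `|s| ^+ k.+2.
Proof.
apply: le_trans (exprn_bernoulli k.+1 (normr_ge0 t) (normr_ge0 s)).
rewrite lerD2l /slope exprS -!mulrA ler_wpM2l// mulrCA.
rewrite [leRHS]mulrCA ler_wpM2l ?exprn_ge0//.
rewrite !mulrBr -expr2 -(real_normK (num_real t)) expr2 lerB//.
by rewrite -normrM ler_norm.
Qed.

Lemma le_slope (k : nat) : {homo slope k : s t / s <= t}.
Proof.
move=> s t st; rewrite /slope ler_wpM2l//.
have [s0|s0] := leP 0 s.
  have t0 := le_trans s0 st.
  by rewrite !ger0_norm// -!exprS lerXn2r.
have [t0|t0] := leP 0 t.
  apply: (@le_trans _ _ 0).
    by rewrite mulr_le0_ge0 ?exprn_ge0// ltW.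
  by rewrite mulr_ge0 ?exprn_ge0.
rewrite !ltr0_norm// -[leLHS]opprK -mulNr -exprS -[leRHS]opprK -mulNr -exprS.
by rewrite lerN2 lerXn2r ?nnegrE; lra.
Qed.

(** Summation by parts: the sum up to [j] is [d j * M j.+1] plus the terms
    [(d i - d i.+1) * M i.+1], which are nonnegative. The induction keeps the boundary term, which
    vanishes at the end. *)
Lemma abel_sum_ge0 n d (M : nat -> R) :
  (forall j, (j.+1 < n)%N -> d j.+1 <= d j) -> (forall j, (j <= n)%N -> 0 <= M j) ->
  M 0%N = 0 -> M n = 0 -> 0 <= \sum_(j < n) d j * (M j.+1 - M j).
Proof.
move=> dd M0 M00 Mn.
suff H j : (j < n)%N -> d j * M j.+1 <= \sum_(i < j.+1) d i * (M i.+1 - M i).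
  case: n dd M0 Mn H => [|n] dd M0 Mn H; first by rewrite big_ord0.
  by rewrite (le_trans _ (H n _))// Mn mulr0.
elim: j => [|j IH] jn; first by rewrite big_ord_recr big_ord0 /= M00 subr0 add0r.
rewrite big_ord_recr /=; have := IH (ltnW jn).
have := ler_wpM2r (M0 j.+1 (ltnW jn)) (dd j jn); lra.
Qed.

(** Lipschitz bound that controls the cost of replacing X and Y by their bin averages. *)
Lemma ler_normX_dist (k : nat) (a b : R) : `|a| <= 1 -> `|b| <= 1 ->
  `|a| ^+ k <= `|b| ^+ k + k%:R * `|a - b|.
Proof.
move=> a1 b1; elim: k => [|k IH]; first by rewrite mul0r addr0.
have ab : `|a| <= `|b| + `|a - b|.
  by rewrite -[in leLHS](subrK b a) (le_trans (ler_normD _ _))// addrC.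
rewrite !exprS.
have h1 : `|a| * `|a| ^+ k <= `|a| * (`|b| ^+ k + k%:R * `|a - b|).
  by rewrite ler_wpM2l.
have h2 : `|a| * `|b| ^+ k <= (`|b| + `|a - b|) * `|b| ^+ k.
  by rewrite ler_wpM2r// exprn_ge0.
have h3 : `|a| * (k%:R * `|a - b|) <= k%:R * `|a - b|.
  by rewrite ler_piMl// mulr_ge0.
have h4 : `|a - b| * `|b| ^+ k <= `|a - b|.
  by rewrite ler_piMr// exprn_ile1.
rewrite -[k.+1]addn1 natrD; lra.
Qed.

End algebra.

(** * Step functions on the unit interval and the convex order *)

Section unit_interval.
Variable R : realType.
Local Notation lam := (@lebesgue_measure R).
Implicit Types (p q : nat -> R).

Local Notation U := (uniform_prob (@ltr01 R)).

Lemma integral_uniform01 (h : R -> \bar R) :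
  measurable_fun setT h -> (forall x, 0 <= h x)%E ->
  (\int[U]_x h x = \int[lam]_(x in `[0%R, 1%R]) h x)%E.
Proof. by move=> mh h0; rewrite integral_uniform// subr0 invr1 mul1e. Qed.

Lemma uniform01E (A : set R) : measurable A -> U A = lam (A `&` `[0%R, 1%R]).
Proof.
move=> mA; rewrite -[in LHS](setIT A) -(integral_indic U measurableT mA).
rewrite -integral_indic//.
by rewrite integral_uniform01//; apply/measurable_EFinP; exact: measurable_indic.
Qed.

Lemma integral_cum_itv p n (h : R -> \bar R) : (forall i, 0 <= p i) ->
  measurable_fun setT h -> (forall x, 0 <= h x)%E ->
  (\int[lam]_(x in `]0%R, cum p n]) h x =
   \sum_(i < n) \int[lam]_(x in `]cum p i, cum p i.+1]) h x)%E.
Proof.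
move=> p0 mh h0; elim: n => [|n IH].
  by rewrite big_ord0 cum0 set_itvoc0 integral_set0.
rewrite big_ord_recr/= -IH -ge0_integral_setU//=.
- congr (integral _ _ _); rewrite -itv_bndbnd_setU// bnd_simp.
  + exact: cum_ge0.
  + exact: le_cum.
- exact: measurable_funTS.
- apply/disj_setPS => z [] /=; rewrite !in_itv/= => /andP[_ zp] /andP[pz _].
  by have := le_lt_trans zp pz; rewrite ltxx.
Qed.

Lemma integral_uniform01_cum p n (h : R -> \bar R) : (forall i, 0 <= p i) ->
  cum p n = 1 -> measurable_fun setT h -> (forall x, 0 <= h x)%E ->
  (\int[U]_x h x = \sum_(i < n) \int[lam]_(x in `]cum p i, cum p i.+1]) h x)%E.
Proof.
move=> p0 p1 mh h0; rewrite -integral_cum_itv// p1 integral_uniform01//.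
(* The left-open blocks miss only the point 0, which is null. *)
by rewrite -integral_itv_obnd_cbnd//; exact: measurable_funTS.
Qed.


Lemma lebesgue_measure_itvoc (a b : R) : a <= b -> lam `]a, b] = (b - a)%:E.
Proof.
move=> ab; rewrite lebesgue_measure_itv/= lte_fin.
by case: ltgtP ab => // -> _; rewrite subrr.
Qed.

Lemma step_function_cum p x n (f h : R -> R) : (forall i, 0 <= p i) ->
  cum p n = 1 -> (forall i v, (i < n)%N -> cum p i < v <= cum p i.+1 -> f v = x i) ->
  measurable_fun setT f -> measurable_fun setT h -> (forall v, 0 <= h v) ->
  (\int[U]_v (h (f v))%:E = (\sum_(i < n) p i * h (x i))%:E)%E.
Proof.
move=> p0 p1 fx mf mh h0.
rewrite (integral_uniform01_cum p0 p1)//; last 2 first.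
- by apply/measurable_EFinP; exact: measurableT_comp.
- by move=> v; rewrite lee_fin.
rewrite -sumEFin; apply: eq_bigr => i _.
rewrite (eq_integral (cst (h (x i))%:E)); last first.
  by move=> v /[!inE]/=; rewrite in_itv/= => vi; rewrite (fx i).
rewrite integral_cst//= lebesgue_measure_itvoc; last exact: le_cum.
by rewrite cumS addrAC subrr add0r -EFinM mulrC.
Qed.

Lemma integrable_affine (D : set R) (g : R -> R) (a b : R) : measurable D ->
  (lam D < +oo)%E -> measurable_fun setT g -> (forall v, 0 <= g v <= 1) ->
  lam.-integrable D (fun v => (a + b * g v)%:E).
Proof.
move=> mD Doo mg g01; apply: measurable_bounded_integrable => //.
  by apply: measurable_funTS; apply: measurable_funD => //; exact: measurable_funM.
exists (`|a| + `|b|); split; first exact: num_real.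
move=> M ltM v _ /=; rewrite (le_trans _ (ltW ltM))// (le_trans (ler_normD _ _))//.
have /andP[? ?] := g01 v.
by rewrite lerD2l normrM ler_piMr// ger0_norm.
Qed.

(* The decreasing step function with value [y j] on a block of length [q j] is
   dominated by [g] in the convex order; [M j] is the excess of the integral of
   [g] over that of the step function on the first [j] blocks. The proof sums
   the tangent inequality at the [y j] by parts. *)
Lemma ler_convex_order (k : nat) n q (y M : nat -> R) (g : R -> R) (c : R) :
  (forall j, 0 <= q j) -> cum q n = 1 ->
  (forall j, (j.+1 < n)%N -> y j.+1 <= y j) ->
  measurable_fun setT g -> (forall v, 0 <= g v <= 1) ->
  (forall j, (j < n)%N -> (\int[lam]_(v in `]cum q j, cum q j.+1]) (g v)%:E =
     (q j * y j + (M j.+1 - M j))%:E)%E) ->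
  (forall j, (j <= n)%N -> 0 <= M j) -> M 0%N = 0 -> M n = 0 ->
  ((\sum_(j < n) q j * `|c - y j| ^+ k.+2)%:E <=
    \int[U]_v (`|c - g v| ^+ k.+2)%:E)%E.
Proof.
move=> q0 q1 yd mg g01 Mg M0 M00 Mn.
have mc : measurable_fun setT (fun v => `|c - g v| ^+ k.+2).
  apply: measurable_funX; apply: measurableT_comp => //.
  exact: measurable_funB.
rewrite (integral_uniform01_cum q0 q1)//; last exact/measurable_EFinP.
pose d j := slope k (c - y j).
(* As [y] decreases, so does [- d]; since [M] is nonnegative and vanishes at both ends, the extra
   terms have a nonnegative sum. What remains is an inequality on each block. *)
apply: (@le_trans _ _ (\sum_(j < n) (q j * `|c - y j| ^+ k.+2
     - d j * (M j.+1 - M j))%:E)%E).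
  rewrite sumEFin lee_fin sumrB lerDl -sumrN.
  under eq_bigr do rewrite -mulNr.
  apply: (@abel_sum_ge0 R n (fun j => - d j) M) => // j jn.
  by rewrite lerN2 le_slope// lerD2l lerN2 yd.
apply: lee_sum => j _.
have jq := le_cum q0 (leqnSn j).
have mj : measurable (`]cum q j, cum q j.+1] : set R) by exact: measurable_itv.
have joo : (lam `]cum q j, cum q j.+1] < +oo)%E by rewrite lebesgue_measure_itvoc// ltry.
(* The intermediate term integrates the tangent line at [c - y j], evaluated at [c - g v]; the
   integral of [g] over the block produces the increment of [M]. *)
apply: (@le_trans _ _ (\int[lam]_(v in `]cum q j, cum q j.+1])
    ((`|c - y j| ^+ k.+2 + d j * y j) + (- d j) * g v)%:E)%E).
  under eq_integral do rewrite EFinD.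
  rewrite integralD//; last 2 first.
  - by have := integrable_affine (`|c - y j| ^+ k.+2 + d j * y j) 0 mj joo mg g01;
      apply: eq_integrable => // v _; rewrite mul0r addr0.
  - by have := integrable_affine 0 (- d j) mj joo mg g01;
      apply: eq_integrable => // v _; rewrite add0r.
  under [X in (_ <= _ + X)%E]eq_integral do rewrite EFinM.
  rewrite integralZl//; last first.
    by have := integrable_affine 0 1 mj joo mg g01;
      apply: eq_integrable => // v _; rewrite add0r mul1r.
  rewrite Mg// integral_cst//= lebesgue_measure_itvoc// -!EFinM -EFinD lee_fin cumS.
  by rewrite le_eqVlt; apply/orP; left; apply/eqP; lra.
apply: le_integral => //.
- exact: integrable_affine.
- apply: measurable_bounded_integrable => //; first exact: measurable_funTS.
  exists ((`|c| + 1) ^+ k.+2); split; first exact: num_real.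
  move=> N ltN v _ /=; rewrite (le_trans _ (ltW ltN))// normrX normr_id.
  rewrite lerXn2r ?nnegrE// ?addr_ge0// (le_trans (ler_normB _ _))//.
  by have /andP[? ?] := g01 v; rewrite lerD2l ger0_norm.
- move=> v _; rewrite lee_fin (le_trans _ (slope_tangent k (c - g v) (c - y j)))//.
  by rewrite le_eqVlt; apply/orP; left; apply/eqP; rewrite /d; lra.
Qed.

End unit_interval.

(** * Decreasing staircases, their conjugates and the extremal inequality *)

Section staircase.
Variable R : realType.
Local Notation lam := (@lebesgue_measure R).
Local Notation U := (uniform_prob (@ltr01 R)).

(* The column heights of the Ferrer diagram of [f]. *)
Definition conjugate (f : R -> R) (v : R) : R := fine (U [set u | v < f u]).

Section measurability.
Variable f : R -> R.
Hypothesis mf : measurable_fun setT f.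

Lemma measurable_lt_fun v : measurable [set u : R | v < f u].
Proof.
have := mf measurableT (measurable_itv `]v, +oo[).
by rewrite setTI; congr measurable; apply/seteqP; split=> u /=;
  rewrite in_itv/= andbT.
Qed.

Lemma conjugateE v : (conjugate f v)%:E = U [set u | v < f u].
Proof.
rewrite fineK//; apply: fin_num_measure; exact: measurable_lt_fun.
Qed.

Lemma conjugate_bounds v : 0 <= conjugate f v <= 1.
Proof.
rewrite -2!lee_fin conjugateE measure_ge0/=.
apply: probability_le1; exact: measurable_lt_fun.
Qed.

Lemma conjugate_noninc : nonincreasing_fun (conjugate f).
Proof.
move=> v w vw; rewrite -lee_fin !conjugateE le_measure ?inE//.
- exact: measurable_lt_fun.
- exact: measurable_lt_fun.
- by move=> u /=; exact: le_lt_trans.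
Qed.

Lemma measurable_conjugate : measurable_fun setT (conjugate f).
Proof. exact: nonincreasing_measurable conjugate_noninc. Qed.

End measurability.

Lemma measurable_fun_gtn v : measurable_fun setT (fun t : R => (v < t)%R%:R : R).
Proof.
rewrite (_ : (fun _ => _) = \1_(`]v, +oo[%classic : set R)).
  exact: measurable_indic.
by apply/funext => t; rewrite indicE mem_setE in_itv/= andbT.
Qed.

Lemma measurable_fun_ltn v : measurable_fun setT (fun t : R => (t < v)%R%:R : R).
Proof.
rewrite (_ : (fun _ => _) = \1_(`]-oo, v[%classic : set R)).
  exact: measurable_indic.
by apply/funext => t; rewrite indicE mem_setE in_itv.
Qed.

Lemma integral_lt_itv (a b z : R) : a <= b ->
  (\int[lam]_(v in `]a, b]) (((v : R) < z)%R%:R)%:E)%E =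
  (Num.min z b - Num.min z a)%:E.
Proof.
move=> ab.
transitivity (\int[lam]_(v in `]a, b]) (\1_(`]-oo, z[%classic : set R) v)%:E)%E.
  by apply: eq_integral => v _; rewrite indicE mem_setE in_itv.
rewrite integral_indic//=.
have [za|az] := leP z a.
  rewrite (_ : _ `&` _ = set0).
    by rewrite measure0 (min_l (le_trans za ab)) subrr.
  apply/seteqP; split=> v //=; rewrite !in_itv/= => -[vz /andP[av _]].
  by have := lt_trans av vz; rewrite ltNge za.
have [bz|zb] := ltP b z.
  rewrite (_ : _ `&` _ = `]a, b]%classic) ?lebesgue_measure_itvoc//.
  apply/seteqP; split=> v /=; rewrite !in_itv/=; first by case.
  by move=> /andP[-> vb]; rewrite vb (le_lt_trans vb bz).
rewrite (_ : _ `&` _ = `]a, z[%classic); last first.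
  apply/seteqP; split=> v /=; rewrite !in_itv/=; first by move=> [-> /andP[->]].
  by move=> /andP[-> vz]; rewrite vz (ltW (lt_le_trans vz zb)).
by rewrite lebesgue_measure_itv/= lte_fin az.
Qed.

Section construction.
Variables (m : nat) (p x : nat -> R).
Hypotheses (p0 : forall i, 0 <= p i) (p1 : cum p m = 1).
Hypotheses (x01 : forall i, 0 <= x i <= 1) (xd : forall i, x i.+1 <= x i).
Hypothesis xm : x m = 0.

(* By Abel summation this is [x i] on the block `]cum p i, cum p i.+1]. *)
Definition staircase (u : R) : R :=
  \sum_(i < m) (x i - x i.+1) * (u <= cum p i.+1)%R%:R.

Lemma staircase_noninc : nonincreasing_fun staircase.
Proof.
move=> u v uv; apply: ler_sum => i _; rewrite ler_wpM2l ?subr_ge0//.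
by rewrite ler_nat; case: (leP v _) => // /(le_trans uv) ->.
Qed.

Lemma measurable_staircase : measurable_fun setT staircase.
Proof. exact: nonincreasing_measurable staircase_noninc. Qed.

(** On block [i] the indicator is 0 for [l < i] and 1 for [l >= i], so the sum telescopes to
    [x i - x m], and [x m] is 0. *)
Lemma staircaseE i u : (i < m)%N -> cum p i < u <= cum p i.+1 ->
  staircase u = x i.
Proof.
move=> im /andP[iu ui].
rewrite /staircase -(big_mkord xpredT (fun l => (x l - x l.+1) * (u <= cum p l.+1)%R%:R)).
rewrite (big_cat_nat (n := i))//=; last exact: ltnW.
rewrite big_nat big1 ?add0r; last first.
  move=> l /= li; rewrite leNgt (le_lt_trans _ iu) ?mulr0//.
  exact: le_cum.
rewrite (eq_big_nat _ _ (F2 := fun l => - (x l.+1 - x l))).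
  by rewrite sumrN telescope_sumr ?(ltnW im)// xm sub0r opprK.
move=> l /andP[il lm]; rewrite (le_trans ui) ?mulr1 ?opprB//.
by apply: le_cum.
Qed.

Lemma staircase_bounds u : 0 <= staircase u <= 1.
Proof.
apply/andP; split.
  by apply: sumr_ge0 => i _; rewrite mulr_ge0 ?subr_ge0.
apply: (@le_trans _ _ (\sum_(i < m) (x i - x i.+1))).
  by apply: ler_sum => i _; rewrite ler_piMr ?subr_ge0// lern1 leq_b1.
rewrite -(big_mkord xpredT (fun l => x l - x l.+1)).
under eq_bigr do rewrite -opprB.
rewrite sumrN telescope_sumr// xm sub0r opprK.
by case/andP: (x01 0).
Qed.

(** A value depends only on the Boolean vector of the comparisons [u <= cum p i.+1]. *)
Lemma finite_range_staircase : finite_set (range staircase).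
Proof.
pose F (b : {ffun 'I_m -> bool}) := \sum_(i < m) (x i - x i.+1) * (b i)%:R.
apply: (@sub_finite_set _ _ (range F)).
  move=> _ [u _ <-]; exists [ffun i : 'I_m => u <= cum p i.+1] => //.
  by apply: eq_bigr => i _; rewrite ffunE.
by apply: finite_image; exact: finite_finset.
Qed.

Lemma conjugate_staircase v :
  conjugate staircase v = \sum_(i < m) p i * (v < x i)%R%:R.
Proof.
have mE := measurable_lt_fun measurable_staircase v.
apply: EFin_inj; rewrite conjugateE; last exact: measurable_staircase.
(* The indicator of [v < staircase u] is constant on each block, with value that of [v < x i]. *)
rewrite -(@step_function_cum R p x m staircase (fun t => (v < t)%R%:R))//.
- rewrite -[in LHS](setIT [set u | _]) -(integral_indic _ measurableT)//.
  by apply: eq_integral => u _; rewrite indicE mem_setE.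
- by move=> i u im iu; exact: staircaseE.
- exact: measurable_staircase.
- exact: measurable_fun_gtn.
Qed.

Lemma integral_conjugate_staircase a b : a <= b ->
  (\int[lam]_(v in `]a, b]) (conjugate staircase v)%:E)%E =
  (\sum_(i < m) p i * (Num.min (x i) b - Num.min (x i) a))%:E.
Proof.
move=> ab; under eq_integral do rewrite conjugate_staircase -sumEFin.
rewrite ge0_integral_sum//=; last 2 first.
- move=> i; apply/measurable_EFinP/measurable_funTS.
  by apply: measurable_funM => //; exact: measurable_fun_ltn.
- by move=> i v _; rewrite lee_fin mulr_ge0.
rewrite -sumEFin; apply: eq_bigr => i _.
under eq_integral do rewrite EFinM.
rewrite ge0_integralZl//=; last 2 first.
- by apply/measurable_EFinP/measurable_funTS; exact: measurable_fun_ltn.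
- by rewrite lee_fin.
by rewrite integral_lt_itv.
Qed.

End construction.

Lemma staircase_moment_ge (k m n : nat) (p x q y : nat -> R) (a : nat -> nat -> R) :
  (forall i, 0 <= p i) -> cum p m = 1 ->
  (forall i, 0 <= x i <= 1) -> (forall i, x i.+1 <= x i) -> x m = 0 ->
  (forall j, 0 <= q j) -> cum q n = 1 ->
  (forall j, (j.+1 < n)%N -> y j.+1 <= y j) ->
  (forall i j, 0 <= a i j <= p i * q j) ->
  (forall i, (i < m)%N -> \sum_(j < n) a i j = p i * x i) ->
  (forall j, (j < n)%N -> \sum_(i < m) a i j = q j * y j) ->
  exists f : R -> R, [/\ nonincreasing_fun f, (forall u, 0 <= f u <= 1),
    finite_set (range f) &
    ((\sum_(i < m) p i * (\sum_(j < n) q j * `|x i - y j| ^+ k.+2))%:E <=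
    \int[U]_u \int[U]_v (`|f u - conjugate f v| ^+ k.+2)%:E)%E].
Proof.
move=> p0 p1 x01 xd xm q0 q1 yd a01 ax ay.
pose f := staircase m p x.
have mf : measurable_fun setT f by exact: measurable_staircase.
have mg := measurable_conjugate mf.
exists f; split; [exact: staircase_noninc|exact: staircase_bounds|
  exact: finite_range_staircase|].
(* The first sum is the integral of [conjugate f] over [[0, cum q j]]; the second is the total of
   the first [j] columns of [a]. *)
pose M j := \sum_(i < m) p i * Num.min (x i) (cum q j) - \sum_(l < j) q l * y l.
have H c : ((\sum_(j < n) q j * `|c - y j| ^+ k.+2)%:E <=
    \int[U]_v (`|c - conjugate f v| ^+ k.+2)%:E)%E.
  apply: (@ler_convex_order _ _ _ _ _ M) => //.
  - exact: conjugate_bounds.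
  - move=> j jn; rewrite integral_conjugate_staircase//; last exact: le_cum.
    congr (_%:E); rewrite /M big_ord_recr/=.
    under eq_bigr do rewrite mulrBr.
    rewrite sumrB; lra.
  (* Row by row: the first [j] entries of row [i] sum to at most the whole row, [p i * x i], and to
     at most [p i * cum q j] by the entrywise bound. *)
  - move=> j jn; rewrite /M subr_ge0.
    rewrite (eq_bigr (fun l : 'I_j => \sum_(i < m) a i l)); last first.
      by move=> l _; rewrite ay// (leq_trans _ jn).
    rewrite exchange_big; apply: ler_sum => i _ /=.
    have := p0 i; have := x01 i => /andP[xi0 _] pi0.
    rewrite minr_pMr// le_min; apply/andP; split.
      rewrite -ax// -(big_mkord xpredT (a i)) -(big_mkord xpredT (a i)).
      rewrite [leRHS](big_cat_nat (n := j))//= lerDl sumr_ge0// => l _.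
      by case/andP: (a01 i l).
    rewrite /cum mulr_sumr ler_sum// => l _.
    by case/andP: (a01 i l).
  - rewrite /M big_ord0 subr0 cum0 big1// => i _.
    by rewrite min_r ?mulr0//; case/andP: (x01 i).
  (* Since [x i] is at most 1, both terms are the total of the matrix [a], summed by rows and by
     columns. *)
  - rewrite /M q1; apply/eqP; rewrite subr_eq0; apply/eqP.
    transitivity (\sum_(i < m) \sum_(j < n) a i j).
      apply: eq_bigr => i _; rewrite ax// min_l//.
      by case/andP: (x01 i).
    by rewrite exchange_big/=; apply: eq_bigr => j _; rewrite ay.
have mphi : measurable_fun setT (fun c : R => \sum_(j < n) q j * `|c - y j| ^+ k.+2).
  apply: measurable_sum => j; apply: measurable_funM => //.
  apply: measurable_funX; apply: measurableT_comp => //.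
  exact: measurable_funB.
(* The sum over [i] is read as an integral over [u] with [c = f u], so that [H] applies
   pointwise. *)
rewrite -(@step_function_cum _ _ _ _ f
  (fun c => \sum_(j < n) q j * `|c - y j| ^+ k.+2))//; last 2 first.
- by move=> i v im iv; exact: staircaseE.
- by move=> c; apply: sumr_ge0 => j _; rewrite mulr_ge0 ?exprn_ge0.
apply: ge0_le_integral => //.
- by move=> u _; rewrite lee_fin; apply: sumr_ge0 => j _; rewrite mulr_ge0 ?exprn_ge0.
- by apply/measurable_EFinP; exact: measurableT_comp mphi mf.
- apply: (measurable_fun_fubini_tonelli_F
    (fun z : measurableTypeR R * measurableTypeR R =>
       (`|f z.1 - conjugate f z.2| ^+ k.+2)%:E)).
    apply/measurable_EFinP/measurable_funX; apply: measurableT_comp => //.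
    by apply: measurable_funB; apply: measurableT_comp.
  by move=> z; rewrite lee_fin exprn_ge0.
Qed.

End staircase.

(** * Moments of a Ferrer diagram as iterated integrals *)

Section ferrer_moment.
Variable R : realType.
Local Notation lam := (@lebesgue_measure R).
Local Notation U := (uniform_prob (@ltr01 R)).
Local Notation plane := (measurableTypeR R * measurableTypeR R)%type.

(** The completed sigma-field contains the product one. Pushing forward along this identity
    restricts the completed measure to the product sigma-field, where Tonelli is available. *)
Lemma measurable_to_plane :
  measurable_fun setT (id : lebesgue_plane R -> plane).
Proof.
by move=> _ Y mY; rewrite setTI preimage_id; exact: caratheodory_measurable_mu_ext.
Qed.

(** By uniqueness of the product measure it suffices to treat rectangles, whose intersection with
    the unit square is again a rectangle. *)
Lemma unit_square_probE (A : set plane) : measurable A ->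
  unit_square_prob R A = (U \x U)%E A.
Proof.
move=> mA; symmetry.
pose m' : {measure set plane -> \bar R} :=
  measure_function_pushforward__canonical__measure_function_Measure
    (unit_square_prob R) measurable_to_plane.
apply: (product_measure_unique (m' := m')) mA => B C mB mC.
rewrite /m' /= /pushforward preimage_id /unit_square_prob /mrestr.
rewrite /completed_measure_extension.
have -> : (B `*` C) `&` @unit_square R = (B `&` `[0, 1]) `*` (C `&` `[0, 1]).
  by apply/seteqP; split=> -[u v] [[/= ? ?] [/= ? ?]].
rewrite measurable_mu_extE; last by apply: measurableX; exact: measurableI.
rewrite [LHS]product_measure1E//; [|exact: measurableI..].
by rewrite !uniform01E.
Qed.

Lemma integral_unit_square_prob (h : plane -> \bar R) :
  measurable_fun setT h -> (forall z, 0 <= h z)%E ->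
  (\int[unit_square_prob R]_z h z = \int[U]_u \int[U]_v h (u, v))%E.
Proof.
move=> mh h0; rewrite -fubini_tonelli1//.
pose m' : {measure set plane -> \bar R} :=
  measure_function_pushforward__canonical__measure_function_Measure
    (unit_square_prob R) measurable_to_plane.
transitivity (\int[m']_z h z)%E.
  rewrite [RHS](ge0_integral_pushforward measurable_to_plane)//.
by apply: eq_measure_integral => A mA _; exact: unit_square_probE.
Qed.

Lemma finite_set_null (D : set R) : finite_set D -> measurable D /\ lam D = 0%E.
Proof.
move=> /finite_set_countable cD; split; last exact: countable_lebesgue_measure0.
by apply: countable_measurable cD => t; exact: measurable_set1.
Qed.

(** Preimages under [f] and [g] differ only inside [D], all of whose subsets are Borel. Needed for
    [ferrer_x], whose values at the jumps are left undetermined. *)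
Lemma measurable_fun_finite_modif (D : set R) (f g : R -> R) : finite_set D ->
  measurable_fun setT f -> (forall u, ~ D u -> g u = f u) -> measurable_fun setT g.
Proof.
move=> fD mf gf _ B mB; rewrite setTI.
have -> : g @^-1` B = (f @^-1` B `\` D) `|` (D `&` g @^-1` B).
  apply/seteqP; split => u /=.
    by move=> gB; have [Du|Du] := pselect (D u); [right|left; rewrite -gf].
  by move=> [[fB /gf ->//]|[]].
apply: measurableU.
  apply: measurableD; last by case: (finite_set_null fD).
  by rewrite -[_ @^-1` _]setTI; exact: mf.
by case: (@finite_set_null (D `&` g @^-1` B)) => //; apply: sub_finite_set fD => u [].
Qed.

Section step.
Variable f : R -> R.
Hypotheses (fd : nonincreasing_fun f) (f01 : forall u, 0 <= f u <= 1).
Hypothesis ff : finite_set (range f).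

Lemma measurable_noninc : measurable_fun setT f.
Proof. exact: nonincreasing_measurable. Qed.
Let mf := measurable_noninc.

Lemma ferrer_int_lt u v : ferrer_int f (u, v) -> v < f u.
Proof. by move=> [[_ /=]]. Qed.

(* The endpoints of the intervals of [0, 1] on which [f] is constant. *)
Definition jumps : set R :=
  (fun c => inf (`[0, 1] `&` f @^-1` [set c])) @` range f `|`
  (fun c => sup (`[0, 1] `&` f @^-1` [set c])) @` range f.

Lemma finite_jumps : finite_set jumps.
Proof. by rewrite finite_setU; split; exact: finite_image. Qed.

(** A point that is neither the infimum nor the supremum of its level set has points of that set on
    both sides, and monotonicity makes [f] constant between them. *)
Lemma locally_constant u : `[0, 1]%classic u -> ~ jumps u ->
  exists a b, [/\ a < u, u < b & forall w, a < w < b -> f w = f u].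
Proof.
move=> u01 ju; pose E := `[0, 1]%classic `&` f @^-1` [set f u].
have Eu : E u by split.
have Eub : has_ubound E by exists 1 => w [/=]; rewrite in_itv/= => /andP[].
have Elb : has_lbound E by exists 0 => w [/=]; rewrite in_itv/= => /andP[].
have iu : inf E < u.
  rewrite lt_neqAle ge_inf// andbT; apply/eqP => iEu; apply: ju; left.
  by exists (f u) => //; exists u.
have us : u < sup E.
  rewrite lt_neqAle ub_le_sup// andbT; apply/eqP => iEu; apply: ju; right.
  by exists (f u) => //; exists u.
have [a [_ fa] au] := inf_lt (ex_intro _ u Eu) iu.
have [b [_ fb] ub] := sup_gt (ex_intro _ u Eu) us.
exists a, b; split => // w /andP[aw wb]; apply/eqP; rewrite eq_le.
by rewrite -[in leRHS]fa -[in X in _ && X]fb !fd// ltW.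
Qed.

(** Where [f] is constant on []a, b[], the box []a, b[] times []-oo, f u[] meets the square inside
    the diagram. The boundary is relative to the square, so points on its edges are included. *)
Lemma ferrer_intP u v : `[0, 1]%classic u -> `[0, 1]%classic v -> ~ jumps u ->
  v < f u -> ferrer_int f (u, v).
Proof.
move=> u01 v01 ju vf.
have Fuv : ferrer f (u, v) by split.
split => // -[_]; apply; rewrite /interior/=.
have -> : nbhs ((u, v) : subspace (@unit_square R)) =
    within (@unit_square R) (nbhs (u, v)).
  by rewrite nbhs_subspace_in.
have [a [b [au ub fE]]] := locally_constant u01 ju.
rewrite /within/=.
exists (`]a, b[%classic, `]-oo, f u[%classic).
  split => /=; apply: open_nbhs_nbhs; split => //=.
  - by rewrite in_itv/= au.
move=> [w z] /= []; rewrite !in_itv/= => wab zf wz01; split => //=.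
by rewrite fE.
Qed.

Lemma ferrer_xE u : `[0, 1]%classic u -> ~ jumps u -> ferrer_x f u = f u.
Proof.
move=> u01 ju; rewrite /ferrer_x.
rewrite (_ : [set v | _] = `[0, f u[%classic).
  rewrite lebesgue_measure_itv/= lte_fin; case/andP: (f01 u) => f0 f1.
  by case: ltgtP f0 => //= _ _; rewrite subr0.
apply/seteqP; split => v /=.
  move=> [v01 /ferrer_int_lt]; move: v01.
  by rewrite !in_itv/= => /andP[-> _].
rewrite in_itv/= => /andP[v0 vf].
have v01 : v \in `[0, 1].
  by rewrite in_itv/= v0 (le_trans (ltW vf))//; case/andP: (f01 u).
by split => //; exact: ferrer_intP.
Qed.

Lemma ferrer_x_out u : ~ `[0, 1]%classic u -> ferrer_x f u = 0.
Proof.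
move=> u01; rewrite /ferrer_x (_ : [set v | _] = set0) ?measure0//.
by apply/seteqP; split => v //= -[_ [[[]]]].
Qed.

Lemma ferrer_y_out v : ~ `[0, 1]%classic v -> ferrer_y f v = 0.
Proof.
move=> v01; rewrite /ferrer_y (_ : [set u | _] = set0) ?measure0//.
by apply/seteqP; split => u //= -[_ [[[]]]].
Qed.

(** At a fixed height the diagram and its interior differ only at jumps, a finite and hence null set
    [D]. So no exceptional [v] arises, in contrast with [ferrer_x]. *)
Lemma ferrer_yE v : `[0, 1]%classic v -> ferrer_y f v = conjugate f v.
Proof.
move=> v01; rewrite /ferrer_y /conjugate; congr fine.
rewrite uniform01E; last exact: measurable_lt_fun.
pose D := jumps `&` [set u | (u \in `[0, 1]) /\ v < f u /\ ~ ferrer_int f (u, v)].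
have fD : finite_set D by apply: sub_finite_set finite_jumps => u [].
have [mD D0] := finite_set_null fD.
have mS : measurable ([set u | v < f u] `&` `[0%R, 1%R]).
  by apply: measurableI => //; exact: measurable_lt_fun.
have -> : [set u | u \in `[0, 1] /\ ferrer_int f (u, v)] =
   ([set u | v < f u] `&` `[0%R, 1%R]) `\` D.
  apply/seteqP; split => u /=.
    move=> [u01 uv]; split; first by split => //; exact: ferrer_int_lt uv.
    by move=> [_ [_ [_]]].
  move=> [[vf u01] nD]; split => //; apply: contrapT => nuv; apply: nD; split.
    by apply: contrapT => ju; apply: nuv; exact: ferrer_intP.
  by split.
have SD0 := subset_measure0 (mu := lam) (measurableI _ _ mS mD) mD (@subIsetr _ _ _) D0.
by rewrite [RHS](measureDI lam mS mD)/= SD0 adde0.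
Qed.

Lemma measurable_ferrer_x : measurable_fun setT (ferrer_x f).
Proof.
pose g (u : R) : R := f u * \1_(`[0, 1]%classic : set R) u.
apply: (measurable_fun_finite_modif (f := g) finite_jumps).
- by apply: measurable_funM => //; exact: measurable_indic.
- move=> u ju; rewrite /g indicE; have [u01|u01] := boolP (u \in _);
    rewrite ?inE ?notin_setE in u01.
    by rewrite mulr1 ferrer_xE.
  by rewrite mulr0 ferrer_x_out.
Qed.

Lemma measurable_ferrer_y : measurable_fun setT (ferrer_y f).
Proof.
rewrite (_ : ferrer_y f = (fun v => conjugate f v * \1_(`[0, 1]%classic : set R) v)).
  by apply: measurable_funM; [exact: measurable_conjugate|exact: measurable_indic].
apply/funext => v; rewrite indicE; have [v01|v01] := boolP (v \in _);
  rewrite ?inE ?notin_setE in v01.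
  by rewrite mulr1 ferrer_yE.
by rewrite mulr0 ferrer_y_out.
Qed.

(** In the inner integral [ferrer_y] is replaced everywhere on [[0, 1]]; in the outer one [ferrer_x]
    is replaced by [f] off the null set [jumps]. *)
Lemma ferrer_moment k :
  ('E_(unit_square_prob R)[fun p => (`|ferrer_X f p - ferrer_Y f p| ^+ k)%R] =
   \int[U]_u \int[U]_v (`|f u - conjugate f v| ^+ k)%:E)%E.
Proof.
have mpow (g h : plane -> R) : measurable_fun setT g -> measurable_fun setT h ->
    measurable_fun setT (fun z => (`|g z - h z| ^+ k)%:E).
  move=> mg mh; apply/measurable_EFinP/measurable_funX.
  by apply: measurableT_comp => //; exact: measurable_funB.
have m1 (c : R) (g : R -> R) : measurable_fun setT g ->
    measurable_fun setT (fun v => (`|c - g v| ^+ k)%:E).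
  move=> mg; apply/measurable_EFinP/measurable_funX.
  by apply: measurableT_comp => //; exact: measurable_funB.
have mx := measurable_ferrer_x; have my := measurable_ferrer_y.
have mc := measurable_conjugate mf.
have pow0 (t : R) : (0 <= (`|t| ^+ k)%:E)%E by rewrite lee_fin exprn_ge0.
rewrite unlock (@integral_unit_square_prob
  (fun z => (`|ferrer_x f z.1 - ferrer_y f z.2| ^+ k)%:E))//; last first.
  by apply: mpow; apply: measurableT_comp.
transitivity (\int[U]_u \int[U]_v (`|ferrer_x f u - conjugate f v| ^+ k)%:E)%E.
  apply: eq_integral => u _ /=.
  rewrite !integral_uniform01//; last 2 first.
  - exact: m1.
  - exact: m1.
  by apply: eq_integral => v /[!inE] v01; rewrite ferrer_yE.
have mF (g : R -> R) : measurable_fun setT g ->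
    measurable_fun setT (fun u : R => \int[U]_v (`|g u - conjugate f v| ^+ k)%:E)%E.
  move=> mg.
  apply: (measurable_fun_fubini_tonelli_F
    (fun z : plane => (`|g z.1 - conjugate f z.2| ^+ k)%:E)) => //.
  by apply: mpow; apply: measurableT_comp.
rewrite !integral_uniform01//; last 4 first.
- exact: mF.
- by move=> u; exact: integral_ge0.
- exact: mF.
- by move=> u; exact: integral_ge0.
apply: ge0_ae_eq_integral => //.
- by apply: measurable_funTS; exact: mF.
- by apply: measurable_funTS; exact: mF.
- by move=> u _; exact: integral_ge0.
- by move=> u _; exact: integral_ge0.
exists jumps; have [mj j0] := finite_set_null finite_jumps; split => //.
move=> u /= nE; apply: contrapT => ju; apply: nE => u01.
by rewrite ferrer_xE.
Qed.

End step.

End ferrer_moment.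

(** * Coherence and independence of the pair given by a Ferrer diagram *)

Section ferrer_coherent.
Variable R : realType.
Local Notation lam := (@lebesgue_measure R).
Local Notation U := (uniform_prob (@ltr01 R)).
Local Notation plane := (measurableTypeR R * measurableTypeR R)%type.

(** By Tonelli the indicator of [C] leaves the inner integral, so only fibre integrals matter. This
    gives the defining identity of a conditional probability given the first coordinate. *)
Lemma integral_fst_strip (g1 g2 : plane -> \bar R) (C : set R) :
  measurable C -> measurable_fun setT g1 -> measurable_fun setT g2 ->
  (forall z, 0 <= g1 z)%E -> (forall z, 0 <= g2 z)%E ->
  (forall u, \int[U]_v g1 (u, v) = \int[U]_v g2 (u, v))%E ->
  (\int[(U \x U)%E]_(z in fst @^-1` C) g1 z =
   \int[(U \x U)%E]_(z in fst @^-1` C) g2 z)%E.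
Proof.
move=> mC mg1 mg2 g10 g20 g12.
have mi : measurable_fun setT (fun z : plane => (\1_C z.1 : R)%:E).
  by apply/measurable_EFinP; apply: measurableT_comp; [exact: measurable_indic|].
have E (g : plane -> \bar R) : measurable_fun setT g -> (forall z, 0 <= g z)%E ->
    (\int[(U \x U)%E]_(z in fst @^-1` C) g z =
     \int[U]_u ((\1_C u)%:E * \int[U]_v g (u, v)))%E.
  move=> mg g0; rewrite integral_mkcond epatch_indic.
  rewrite fubini_tonelli1//=; last 2 first.
  - exact: emeasurable_funM.
  - by move=> z; rewrite mule_ge0// lee_fin.
  apply: eq_integral => u _; rewrite /fubini_F.
  rewrite -ge0_integralZl//=; last first.
    by apply: measurableT_comp.
  by apply: eq_integral => v _; rewrite muleC.
by rewrite !E//; apply: eq_integral => u _; rewrite g12.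
Qed.

Lemma integral_snd_strip (g1 g2 : plane -> \bar R) (C : set R) :
  measurable C -> measurable_fun setT g1 -> measurable_fun setT g2 ->
  (forall z, 0 <= g1 z)%E -> (forall z, 0 <= g2 z)%E ->
  (forall v, \int[U]_u g1 (u, v) = \int[U]_u g2 (u, v))%E ->
  (\int[(U \x U)%E]_(z in snd @^-1` C) g1 z =
   \int[(U \x U)%E]_(z in snd @^-1` C) g2 z)%E.
Proof.
move=> mC mg1 mg2 g10 g20 g12.
have mi : measurable_fun setT (fun z : plane => (\1_C z.2 : R)%:E).
  by apply/measurable_EFinP; apply: measurableT_comp; [exact: measurable_indic|].
have E (g : plane -> \bar R) : measurable_fun setT g -> (forall z, 0 <= g z)%E ->
    (\int[(U \x U)%E]_(z in snd @^-1` C) g z =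
     \int[U]_v ((\1_C v)%:E * \int[U]_u g (u, v)))%E.
  move=> mg g0; rewrite integral_mkcond epatch_indic.
  rewrite fubini_tonelli2//=; last 2 first.
  - exact: emeasurable_funM.
  - by move=> z; rewrite mule_ge0// lee_fin.
  apply: eq_integral => v _; rewrite /fubini_G.
  rewrite -ge0_integralZl//=; last first.
    by apply: measurableT_comp.
  by apply: eq_integral => u _; rewrite muleC.
by rewrite !E//; apply: eq_integral => u _; rewrite g12.
Qed.

Lemma measurable_gt (c : R) : measurable [set v : R | v < c].
Proof.
rewrite (_ : [set v | v < c] = `]-oo, c[%classic); first exact: measurable_itv.
by apply/seteqP; split => v; rewrite /= in_itv.
Qed.

Lemma uniform01_lt (c : R) : 0 <= c <= 1 -> U [set v | v < c] = c%:E.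
Proof.
move=> /andP[c0 c1].
rewrite (_ : [set v | v < c] = `]-oo, c[%classic); last first.
  by apply/seteqP; split => v; rewrite /= in_itv.
rewrite uniform01E// (_ : _ `&` _ = `[0, c[%classic).
  rewrite lebesgue_measure_itv/= lte_fin.
  by case: ltgtP c0 => [_||<-] //= _; rewrite ?sube0 ?oppr0 ?adde0 ?subr0.
apply/seteqP; split => v /=; rewrite !in_itv/=; first by move=> [-> /andP[->]].
by move=> /andP[-> vc]; rewrite vc (ltW (lt_le_trans vc c1)).
Qed.

Lemma mfun_exists d d' (T : measurableType d) (T' : measurableType d') (g : T -> T') :
  measurable_fun setT g -> exists X : {mfun T >-> T'}, (X : T -> T') = g.
Proof.
move=> mg; pose m := isMeasurableFun.Build _ _ _ _ _ mg.
by exists (HB.pack g m : {mfun T >-> T'}).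
Qed.

Lemma sub_sigma_field_preimage d d' (T : measurableType d) (T' : measurableType d')
    (pi : T -> T') : measurable_fun setT pi ->
  sub_sigma_field (preimage_set_system setT pi measurable).
Proof.
move=> mpi; split.
  apply: sigma_algebra_preimage; split => //.
  - by move=> A mA; rewrite setTD; exact: measurableC.
  - by move=> F mF; exact: bigcup_measurable.
by move=> _ [C mC <-]; exact: mpi.
Qed.

Variable f : R -> R.
Hypotheses (fd : nonincreasing_fun f) (f01 : forall u, 0 <= f u <= 1).

Lemma ferrer_coherent : exists X Y : {RV (U \x U)%E >-> R},
  [/\ (X : plane -> R) = f \o fst, (Y : plane -> R) = conjugate f \o snd,
      coherent X Y & independent X Y].
Proof.
have mf : measurable_fun setT f by exact: nonincreasing_measurable.
have mg := measurable_conjugate mf.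
have [X XE] := mfun_exists (measurableT_comp mf
  (@measurable_fst _ _ (measurableTypeR R) (measurableTypeR R))).
have [Y YE] := mfun_exists (measurableT_comp mg
  (@measurable_snd _ _ (measurableTypeR R) (measurableTypeR R))).
exists X, Y; split => //.
(* The event is the whole region below the graph; its part outside the unit square has no mass under
   [U \x U]. *)
- pose A : set plane := [set z | z.2 < f z.1].
  have mA : measurable A.
    have mh : measurable_fun setT (fun z : plane => f z.1 - z.2).
      by apply: measurable_funB => //; exact: measurableT_comp.
    have := mh measurableT _ (measurable_itv `]0, +oo[).
    rewrite setTI; congr measurable; apply/seteqP; split=> z /=;
      by rewrite in_itv/= andbT subr_gt0.
  exists A, (preimage_set_system setT fst measurable),
    (preimage_set_system setT snd measurable).
  have miA : measurable_fun setT (fun z : plane => (\1_A z : R)%:E).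
    by apply/measurable_EFinP; exact: measurable_indic.
  have int01 (h : plane -> R) : measurable_fun setT h -> (forall z, 0 <= h z <= 1) ->
    (U \x U)%E.-integrable setT (EFin \o h).
    move=> mh h01; apply: measurable_bounded_integrable => //.
      by rewrite [ltLHS]probability_setT ltry.
    exists 1; split; first exact: num_real.
    move=> M ltM z _ /=; rewrite (le_trans _ (ltW ltM))//.
    by case/andP: (h01 z) => h0 h1; rewrite ger0_norm.
  split => //.
  + exact: sub_sigma_field_preimage.
  + exact: sub_sigma_field_preimage.
  + split.
    * move=> _ [B mB <-]; exists (f @^-1` B); last by rewrite XE.
      by rewrite -[_ @^-1` _]setTI; exact: mf.
    * apply: int01 => // z; rewrite XE/=; exact: f01.
    * move=> _ [C mC <-]; rewrite setTI -integral_indic//; last first.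
        by rewrite -[X in measurable X]setTI; exact: measurable_fst.
      rewrite XE; apply: integral_fst_strip => //.
      - by apply/measurable_EFinP; exact: measurableT_comp.
      - by move=> z /=; rewrite lee_fin; case/andP: (f01 z.1).
      (* The fibre of the event over [u] is the set of [v] below [f u], of mass [f u]. *)
      - move=> u /=; rewrite integral_cst// [X in (_ * X)%E]probability_setT mule1.
        rewrite -[RHS]/(\int[U]_v (\1_[set v | v < f u] v)%:E)%E.
        rewrite integral_indic ?setIT; [by rewrite [RHS]uniform01_lt|by []|].
        exact: measurable_gt.
  + split.
    * move=> _ [B mB <-]; exists (conjugate f @^-1` B); last by rewrite YE.
      by rewrite -[_ @^-1` _]setTI; exact: mg.
    * by apply: int01 => // z; rewrite YE/=; exact: conjugate_bounds.
    * move=> _ [C mC <-]; rewrite setTI -integral_indic//; last first.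
        by rewrite -[X in measurable X]setTI; exact: measurable_snd.
      rewrite YE; apply: integral_snd_strip => //.
      - by apply/measurable_EFinP; exact: measurableT_comp.
      - by move=> z /=; rewrite lee_fin; case/andP: (conjugate_bounds mf z.2).
      - move=> v /=; rewrite integral_cst// [X in (_ * X)%E]probability_setT mule1.
        rewrite conjugateE//.
        rewrite -[RHS]/(\int[U]_u (\1_[set u | v < f u] u)%:E)%E.
        by rewrite integral_indic ?setIT//; exact: measurable_lt_fun.
- move=> B C mB mC; rewrite XE YE.
  have mfB : measurable (f @^-1` B) by rewrite -[_ @^-1` _]setTI; exact: mf.
  have mgC : measurable (conjugate f @^-1` C).
    by rewrite -[_ @^-1` _]setTI; exact: mg.
  rewrite -[X in ((U \x U) X = _)%E]/((f @^-1` B) `*` (conjugate f @^-1` C)).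
  rewrite (_ : (f \o fst) @^-1` B = (f @^-1` B) `*` setT); last first.
    by apply/seteqP; split => z //= -[].
  rewrite (_ : (conjugate f \o snd) @^-1` C = setT `*` (conjugate f @^-1` C)); last first.
    by apply/seteqP; split => z //= -[].
  have U1 : U setT = 1%E by exact: probability_setT.
  rewrite product_measure1E//= [X in (_ = X * _)%E]product_measure1E//=.
  by rewrite [X in (_ = _ * X)%E]product_measure1E//= U1 mule1 mul1e.
Qed.

End ferrer_coherent.

(** * Almost sure bounds on conditional probabilities and binning of their values *)

Section discretization.
Context d (T : measurableType d) (R : realType) (P : probability T R).
Implicit Types (X Y : {RV P >-> R}) (A : set T).

Lemma measurable_RV X (B : set R) : measurable B -> measurable (X @^-1` B).
Proof. by move=> mB; rewrite -[_ @^-1` _]setTI; exact: measurable_funP. Qed.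

(** The integral of [|h|] over [B] is 0, so [h] vanishes almost everywhere on [B]; being positive
    there, it confines [B] to the exceptional null set. *)
Lemma integral_pos_le0_null (B : set T) (h : T -> R) : measurable B ->
  P.-integrable B (EFin \o h) -> (forall w, B w -> 0 < h w) ->
  (\int[P]_(w in B) (h w)%:E <= 0)%E -> P B = 0%E.
Proof.
move=> mB ih h0 ile0.
have mh : measurable_fun B (EFin \o h) by exact: measurable_int ih.
have habs : (\int[P]_(w in B) `|(EFin \o h) w| = 0)%E.
  apply/eqP; rewrite eq_le integral_ge0// andbT (le_trans _ ile0)//.
  by rewrite le_eqVlt; apply/orP; left; apply/eqP; apply: eq_integral => w /[!inE] Bw /=;
    rewrite ger0_norm// ltW// h0.
have /(ae_eq_integral_abs P mB mh)[N [mN N0 BN]] := habs.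
apply: subset_measure0 N0 => // w Bw; apply: BN => /= H.
by have := h0 w Bw; have [->] := H Bw; rewrite ltxx.
Qed.

Section cond_prob.
Variables (A : set T) (G : set (set T)) (X : {RV P >-> R}).
Hypotheses (mA : measurable A) (cX : is_cond_prob A G X).

Lemma integral_preimage (B : set R) : measurable B ->
  (\int[P]_(w in X @^-1` B) (X w)%:E = P (A `&` X @^-1` B))%E.
Proof.
by case: cX => GX _ + mB; apply; apply: GX; exists B => //; rewrite setTI.
Qed.

Lemma cond_prob_integrable (B : set R) : measurable B ->
  P.-integrable (X @^-1` B) (EFin \o X).
Proof.
case: cX => _ iX _ mB; apply: integrableS iX => //; exact: measurable_RV.
Qed.

(** A version of a conditional probability lies in [[0, 1]] only almost surely. Over the event
    [X < 0] the integral of X is the mass of a part of [A], hence nonnegative. *)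
Lemma cond_prob_ge0 : P (X @^-1` `]-oo, 0[) = 0%E.
Proof.
have mB := measurable_itv `]-oo, (0 : R)[.
apply: (@integral_pos_le0_null _ (\- X)).
- exact: measurable_RV.
- rewrite (_ : _ \o _ = \- (EFin \o X))%E//.
  apply: integrableN. exact: cond_prob_integrable.
- by move=> w /=; rewrite in_itv/= oppr_gt0.
- under eq_integral do rewrite EFinN.
  rewrite integralN/=; last first.
    exact: (integrable_add_def (measurable_RV X mB) (cond_prob_integrable mB)).
  by rewrite integral_preimage// oppe_le0.
Qed.

Lemma cond_prob_le1 : P (X @^-1` `]1, +oo[) = 0%E.
Proof.
have mB := measurable_itv `](1 : R), +oo[.
have mXB := measurable_RV X mB.
have i1 : P.-integrable (X @^-1` `]1, +oo[) (cst 1%E).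
  apply/integrableP; split; first exact: measurable_cst.
  rewrite (eq_integral (cst 1%E)) => [|w _]; last by rewrite /= normr1.
  by rewrite integral_cst// mul1e -ge0_fin_numE// fin_num_measure.
(* Over the event [X > 1] the integral of [X - 1] is the mass of its intersection with [A] minus its
   own mass. *)
apply: (@integral_pos_le0_null _ (fun w => X w - 1)) => //.
- rewrite (_ : _ \o _ = (EFin \o X) \- cst 1)%E//.
  by apply: integrableB => //; exact: cond_prob_integrable.
- by move=> w /=; rewrite in_itv/= andbT subr_gt0.
- under eq_integral do rewrite EFinB.
  rewrite integralB//; last exact: cond_prob_integrable.
  rewrite integral_preimage// integral_cst// mul1e.
  by rewrite sube_le0 measureIr.
Qed.

End cond_prob.

Section bins.
Variable N : nat.
Hypothesis N0 : (0 < N)%N.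

(** Descends in steps of [1/N] from [1 + 1/N] at index 0, through 1 at index 1, to 0 at index
    [N.+1]. *)
Definition grid (i : nat) : R := (N.+1%:R - i%:R) / N%:R.

(* The bins are numbered downwards, so that the averages below decrease;
   [bin 0] is needed for the point 1. *)
Definition bin (i : nat) : set R := `[grid i.+1, grid i[%classic.

Lemma gridS i : grid i = grid i.+1 + N%:R^-1.
Proof.
by rewrite /grid -[i.+1]addn1 natrD; lra.
Qed.

Lemma grid_lt i : grid i.+1 < grid i.
Proof. by rewrite [ltRHS]gridS ltrDl invr_gt0 ltr0n. Qed.

Lemma grid0 : grid 0 = 1 + N%:R^-1.
Proof.
by rewrite /grid subr0 -addn1 natrD mulrDl mul1r divff// pnatr_eq0 -lt0n.
Qed.

Lemma grid_last : grid N.+1 = 0.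
Proof. by rewrite /grid subrr mul0r. Qed.

Lemma le_grid i j : (i <= j)%N -> grid j <= grid i.
Proof.
by move=> ij; rewrite /grid ler_wpM2r ?invr_ge0// lerB// ler_nat.
Qed.

Lemma measurable_bin i : measurable (bin i).
Proof. exact: measurable_itv. Qed.

Lemma bin_exists t : 0 <= t <= 1 -> exists2 i, (i < N.+1)%N & bin i t.
Proof.
move=> /andP[t0 t1].
have H n : grid n <= t -> exists2 i, (i < n)%N & bin i t.
  elim: n => [|n IH].
    rewrite grid0 => /le_trans/(_ t1).
    by rewrite gerDl leNgt invr_gt0 ltr0n N0.
  have [/IH[i ni bi] _|tn nt] := leP (grid n) t.
    by exists i => //; exact: ltnW.
  by exists n => //; rewrite /bin/= in_itv/= nt.
by apply: H; rewrite grid_last.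
Qed.

(** The bins join up to [[0, 1 + 1/N[], and the values of X outside it lie in the two null
    events. *)
Lemma sum_bins X (E : set T) : measurable E ->
  P (X @^-1` `]-oo, 0[) = 0%E -> P (X @^-1` `]1, +oo[) = 0%E ->
  \sum_(i < N.+1) fine (P (E `&` X @^-1` bin i)) = fine (P E).
Proof.
move=> mE X0 X1.
have mI (i : interval R) : measurable (E `&` X @^-1` [set` i]).
  by apply: measurableI => //; exact: measurable_RV.
have mEb i : measurable (E `&` X @^-1` bin i) by exact: mI.
have H n : \sum_(i < n) fine (P (E `&` X @^-1` bin i)) =
    fine (P (E `&` X @^-1` `[grid n, grid 0[)).
  elim: n => [|n IH].
    by rewrite big_ord0 set_itvco0 preimage_set0 setI0 measure0.
  rewrite big_ord_recr/= IH -fineD ?fin_num_measure//.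
  rewrite -measureU//.
  - congr (fine (P _)); rewrite -setIUr -preimage_setU; congr (_ `&` X @^-1` _).
    rewrite setUC /bin -itv_bndbnd_setU//; rewrite bnd_simp.
      exact: ltW (grid_lt n).
    exact: le_grid.
  - rewrite setIACA setIid -preimage_setI (_ : _ `&` bin n = set0).
      by rewrite preimage_set0 setI0.
    apply/seteqP; split=> t //=; rewrite /bin/= !in_itv/= => -[/andP[nt _] /andP[_ tn]].
    by have := lt_le_trans tn nt; rewrite ltxx.
rewrite H grid_last grid0; congr fine.
have null : P (E `&` X @^-1` (`]-oo, 0[ `|` `]1, +oo[)) = 0%E.
  apply: (@subset_measure0 _ _ _ P _ (X @^-1` `]-oo, 0[ `|` X @^-1` `]1, +oo[)).
  - by apply: measurableI => //; apply: measurable_RV; exact: measurableU.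
  - by apply: measurableU; exact: measurable_RV.
  - by move=> w [].
  - by rewrite [LHS]measureU0 ?X1//; exact: measurable_RV.
rewrite -[LHS](@measureU0 _ _ _ P _
  (E `&` X @^-1` (`]-oo, 0[ `|` `]1, +oo[)))//; last first.
  by apply: measurableI => //; apply: measurable_RV; exact: measurableU.
rewrite -setIUr -preimage_setU (_ : _ `|` _ = setT) ?preimage_setT ?setIT//.
apply/seteqP; split => t // _; rewrite /= !in_itv/= andbT.
have [t0|t0] := ltP t 0; first by right; left.
have [t1|t1] := ltP 1 t; first by right; right.
by left; rewrite (le_lt_trans t1)// ltrDl invr_gt0 ltr0n.
Qed.

(** In a bin of positive mass the conditional probability of [A] is also the mean of X, so it lies
    between the endpoints of the bin. Monotonicity and the [1/N] error both follow. *)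
Lemma bin_average A G X : measurable A -> is_cond_prob A G X ->
  exists x : nat -> R, [/\ forall i, 0 <= x i <= 1, forall i, x i.+1 <= x i,
    x N.+1 = 0,
    forall i, (i < N.+1)%N ->
      fine (P (A `&` X @^-1` bin i)) = fine (P (X @^-1` bin i)) * x i &
    forall i t, (i < N.+1)%N -> bin i t -> `|t - x i| <= N%:R^-1].
Proof.
move=> mA cX.
have H i : exists xi, (i < N.+1)%N -> [/\ grid i.+1 <= xi <= grid i, 0 <= xi <= 1 &
  fine (P (A `&` X @^-1` bin i)) = fine (P (X @^-1` bin i)) * xi].
  have mB := measurable_bin i; have mXB := measurable_RV X mB.
  have [p0|p0] := eqVneq (P (X @^-1` bin i)) 0%E.
    (* On a null bin any value in the bin satisfies the mass identity; the lower endpoint also stays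
       in [[0, 1]], even for bin 0. *)
    exists (grid i.+1) => iN; split.
    - by rewrite lexx ltW// grid_lt.
    - rewrite -{1}grid_last le_grid//=.
      rewrite /grid ler_pdivrMr ?ltr0n// mul1r lerBlDr -natrD ler_nat.
      by rewrite addnS ltnS leq_addr.
    - by rewrite p0 mul0r (subset_measure0 (mu := P) _ mXB _ p0)//; exact: measurableI.
  have pE : P (X @^-1` bin i) = (fine (P (X @^-1` bin i)))%:E.
    by rewrite fineK// fin_num_measure.
  have aE : P (A `&` X @^-1` bin i) = (fine (P (A `&` X @^-1` bin i)))%:E.
    by rewrite fineK// fin_num_measure//; exact: measurableI.
  have pp : 0 < fine (P (X @^-1` bin i)).
    rewrite fine_gt0// lt0e p0/= measure_ge0/=.
    by rewrite -ge0_fin_numE// fin_num_measure.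
  have iX := cond_prob_integrable cX mB.
  exists (fine (P (A `&` X @^-1` bin i)) / fine (P (X @^-1` bin i))) => iN.
  have ic (c : R) : P.-integrable (X @^-1` bin i) (cst c%:E).
    apply/integrableP; split; first exact: measurable_cst.
    rewrite (eq_integral (cst `|c|%:E)) => [|w _]; last by [].
    by rewrite integral_cst// -ge0_fin_numE ?fin_numM ?fin_num_measure// mule_ge0.
  split.
  - rewrite ler_pdivlMr// ler_pdivrMr// -2!lee_fin (EFinM (grid i.+1)).
    rewrite (EFinM (grid i)) -pE -aE -(integral_preimage cX mB).
    rewrite -!integral_cst//; apply/andP; split; apply: le_integral => //.
    + by move=> w /[!inE]/=; rewrite /bin/= in_itv/= lee_fin => /andP[].
    + by move=> w /[!inE]/=; rewrite /bin/= in_itv/= lee_fin => /andP[_ /ltW].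
  - rewrite divr_ge0 ?fine_ge0//= ler_pdivrMr// mul1r -lee_fin -pE -aE.
    exact: measureIr.
  - by rewrite mulrC divfK// gt_eqF.
have [xi xiP] := choice H.
(* Padding with 0 after the last bin gives the final value 0 that the telescoping in [staircase]
   relies on. *)
exists (fun i => if (i < N.+1)%N then xi i else 0); split.
- by move=> i; case: ifPn => [/xiP[]//|_]; rewrite lexx ler01.
- move=> i; case: ifPn => iN.
    rewrite (ltn_trans _ iN)//; have [/andP[_ h1] _ _] := xiP _ iN.
    by rewrite (le_trans h1)//; have [/andP[]] := xiP _ (ltn_trans (ltnSn i) iN).
  by case: ifPn => // /xiP[_ /andP[]].
- by rewrite ltnn.
- by move=> i iN; rewrite iN; case: (xiP _ iN).
- move=> i t iN; rewrite iN /bin/= in_itv/= => /andP[t1 t2].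
  have [/andP[h1 h2] _ _] := xiP _ iN.
  by have := gridS i; rewrite ler_norml; lra.
Qed.

End bins.

End discretization.

Lemma sum_binsT d (T : measurableType d) (R : realType) (P : probability T R)
    (N : nat) (X : {RV P >-> R}) : (0 < N)%N ->
  P (X @^-1` `]-oo, 0[) = 0%E -> P (X @^-1` `]1, +oo[) = 0%E ->
  \sum_(i < N.+1) fine (P (X @^-1` bin N i)) = 1.
Proof.
move=> N0 X0 X1; have := sum_bins N0 measurableT X0 X1.
rewrite probability_setT /= => <-.
by apply: eq_bigr => i _; rewrite setTI.
Qed.

(** * Comparison of the moment with its binned version *)

Section moment_bound.
Context d (T : measurableType d) (R : realType) (P : probability T R).
Variables X Y : {RV P >-> R}.
Hypothesis XY : independent X Y.

Lemma independent_fine (B C : set R) : measurable B -> measurable C ->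
  fine (P (X @^-1` B `&` Y @^-1` C)) =
  fine (P (X @^-1` B)) * fine (P (Y @^-1` C)).
Proof.
move=> mB mC; rewrite XY// fineM// fin_num_measure//; exact: measurable_RV.
Qed.

Lemma moment_le_bins (k N : nat) (x y : nat -> R) : (0 < N)%N ->
  P (X @^-1` `]-oo, 0[) = 0%E -> P (X @^-1` `]1, +oo[) = 0%E ->
  P (Y @^-1` `]-oo, 0[) = 0%E -> P (Y @^-1` `]1, +oo[) = 0%E ->
  (forall i, 0 <= x i <= 1) -> (forall j, 0 <= y j <= 1) ->
  (forall i t, (i < N.+1)%N -> bin N i t -> `|t - x i| <= N%:R^-1) ->
  (forall j t, (j < N.+1)%N -> bin N j t -> `|t - y j| <= N%:R^-1) ->
  (\int[P]_w (`|X w - Y w| ^+ k)%:E <=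
   (\sum_(i < N.+1) fine (P (X @^-1` bin N i)) *
      (\sum_(j < N.+1) fine (P (Y @^-1` bin N j)) * `|x i - y j| ^+ k) +
    k%:R * (2 / N%:R))%:E)%E.
Proof.
move=> N0 X0 X1 Y0 Y1 x01 y01 xb yb.
pose S (i j : nat) := X @^-1` bin N i `&` Y @^-1` bin N j.
have mS i j : measurable (S i j).
  by apply: measurableI; apply: measurable_RV; exact: measurable_bin.
(* On the cell [S i j] each variable is within [1/N] of its average, so the Lipschitz bound makes
   [c i j] dominate the integrand there. *)
pose c (i j : nat) := `|x i - y j| ^+ k + k%:R * (2 / N%:R).
have c0 i j : 0 <= c i j by rewrite addr_ge0 ?exprn_ge0// mulr_ge0// divr_ge0.
have mF : measurable_fun setT
    (fun w => \sum_(i < N.+1) \sum_(j < N.+1) c i j * \1_(S i j) w).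
  by apply: measurable_sum => i; apply: measurable_sum => j;
    apply: measurable_funM => //; exact: measurable_indic.
have intF : (\int[P]_w (\sum_(i < N.+1) \sum_(j < N.+1) c i j * \1_(S i j) w)%:E =
    (\sum_(i < N.+1) \sum_(j < N.+1) c i j * fine (P (S i j)))%:E)%E.
  under eq_integral do rewrite -sumEFin.
  rewrite ge0_integral_sum//; last 2 first.
  - move=> i; apply/measurable_EFinP; apply: measurable_sum => j.
    by apply: measurable_funM => //; exact: measurable_indic.
  - by move=> i w _; rewrite lee_fin sumr_ge0// => j _; rewrite mulr_ge0.
  rewrite -sumEFin; apply: eq_bigr => i _.
  under eq_integral do rewrite -sumEFin.
  rewrite ge0_integral_sum//; last 2 first.
  - move=> j; apply/measurable_EFinP.
    by apply: measurable_funM => //; exact: measurable_indic.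
  - by move=> j w _; rewrite lee_fin mulr_ge0.
  rewrite -sumEFin; apply: eq_bigr => j _.
  under eq_integral do rewrite EFinM.
  rewrite ge0_integralZl//; last 2 first.
  - by apply/measurable_EFinP; exact: measurable_indic.
  - by rewrite lee_fin.
  by rewrite integral_indic// setIT EFinM fineK// fin_num_measure.
have pq : \sum_(i < N.+1) \sum_(j < N.+1) c i j * fine (P (S i j)) =
    \sum_(i < N.+1) fine (P (X @^-1` bin N i)) *
      (\sum_(j < N.+1) fine (P (Y @^-1` bin N j)) * `|x i - y j| ^+ k) +
    k%:R * (2 / N%:R).
  have sX := sum_binsT N0 X0 X1; have sY := sum_binsT N0 Y0 Y1.
  rewrite /c; move: (k%:R * (2 / N%:R)) => K.
  (* The constant error is spread over the cells by writing 1 as the total mass of the bins, first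
     for X and then for Y. *)
  rewrite -[X in _ + X]mul1r -sX mulr_suml -big_split/=; apply: eq_bigr => i _.
  rewrite -mulrDr -[X in _ + X]mul1r -sY mulr_suml -big_split/= mulr_sumr.
  apply: eq_bigr => j _; rewrite independent_fine; [|exact: measurable_bin..].
  by lra.
rewrite -pq -intF; apply: ae_ge0_le_integral => //.
- apply/measurable_EFinP/measurable_funX; apply: measurableT_comp => //.
  exact: measurable_funB.
- move=> w _; rewrite lee_fin sumr_ge0// => i _.
  by rewrite sumr_ge0// => j _; rewrite mulr_ge0.
- exact/measurable_EFinP.
(* Off this null set both values lie in [[0, 1]], so the point belongs to some cell. *)
pose Z := (X @^-1` `]-oo, 0[ `|` X @^-1` `]1, +oo[) `|`
  (Y @^-1` `]-oo, 0[ `|` Y @^-1` `]1, +oo[).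
have mX0 : measurable (X @^-1` `]-oo, 0[) by exact: measurable_RV.
have mX1 : measurable (X @^-1` `]1, +oo[) by exact: measurable_RV.
have mY0 : measurable (Y @^-1` `]-oo, 0[) by exact: measurable_RV.
have mY1 : measurable (Y @^-1` `]1, +oo[) by exact: measurable_RV.
exists Z; split.
- by apply: measurableU; exact: measurableU.
- rewrite measureU0 ?measureU0//; exact: measurableU.
move=> w /= nle; apply: contrapT => nZ; apply: nle => _.
have Xw : 0 <= X w <= 1.
  apply/andP; split; rewrite leNgt; apply/negP => h; apply: nZ; left; [left|right];
  by rewrite /= in_itv/= ?andbT.
have Yw : 0 <= Y w <= 1.
  apply/andP; split; rewrite leNgt; apply/negP => h; apply: nZ; right; [left|right];
  by rewrite /= in_itv/= ?andbT.
have [i iN bi] := bin_exists N0 Xw.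
have [j jN bj] := bin_exists N0 Yw.
(* The cell containing [w] is singled out; the remaining terms are nonnegative and are dropped. *)
rewrite lee_fin (bigD1 (Ordinal iN))//= (bigD1 (Ordinal jN))//= indicE mem_set//= mulr1.
have xi := x01 i; have yj := y01 j.
have hX := xb _ _ iN bi; have hY := yb _ _ jN bj.
have r0 : 0 <= \sum_(j0 < N.+1 | j0 != Ordinal jN) c i j0 * \1_(S i j0) w +
    \sum_(i0 < N.+1 | i0 != Ordinal iN) \sum_(j0 < N.+1) c i0 j0 * \1_(S i0 j0) w.
  by rewrite addr_ge0 ?sumr_ge0// => *; rewrite ?sumr_ge0// => *; rewrite mulr_ge0.
rewrite -addrA (le_trans (@ler_normX_dist _ k (X w - Y w) (x i - y j) _ _))//.
- by rewrite ler_norml; lra.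
- by rewrite ler_norml; lra.
rewrite -[leLHS]addr0 lerD// lerD2l ler_wpM2l//.
by move: hX hY; rewrite !ler_norml; lra.
Qed.

End moment_bound.

(** * Extension of step functions to the line and equality of the suprema *)

(** Clamping the argument to [[0, 1]] makes the function monotone and bounded on the whole line; the
    diagram reads only arguments in [[0, 1]], where the clamp is the identity. *)
Lemma STEP_extend (R : realType) (f : R -> R) : STEP R f ->
  exists g, [/\ nonincreasing_fun g, forall u, 0 <= g u <= 1,
    finite_set (range g) & ferrer g = ferrer f].
Proof.
move=> [f01 fd ff]; pose cl (u : R) := Num.max 0 (Num.min 1 u).
have cl01 u : cl u \in `[0, 1].
  by rewrite in_itv/= /cl le_max lexx/= ge_max ler01 ge_min lexx.
have clE u : u \in `[0, 1] -> cl u = u.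
  by rewrite in_itv/= => /andP[u0 u1]; rewrite /cl (min_r u1) (max_r u0).
exists (f \o cl); split.
- move=> u v uv; apply: fd => //; rewrite /cl.
  rewrite ge_max le_max lexx/= le_max; apply/orP; right.
  by rewrite le_min !ge_min lexx uv orbT.
- by move=> u; have := f01 _ (cl01 u); rewrite in_itv.
- apply: sub_finite_set ff => _ [u _ <-]; exists (cl u) => //; exact: cl01.
- apply/seteqP; split => -[u v] [[/= u01 v01] /= vf]; split => //=;
  by move: vf; rewrite clE.
Qed.

Lemma eq_ferrer (R : realType) (f g : R -> R) : ferrer f = ferrer g ->
  ferrer_X f = ferrer_X g /\ ferrer_Y f = ferrer_Y g.
Proof.
by move=> fg; rewrite /ferrer_X /ferrer_Y /ferrer_x /ferrer_y /ferrer_int fg.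
Qed.

Theorem proposition5p1 (R : realType) (k : nat) (hk : (3 <= k)%N) :
  ereal_sup [set ('E_(unit_square_prob R)[
                    fun p => (`|ferrer_X f p - ferrer_Y f p| ^+ k)%R])%E
            | f in STEP R]
  = ereal_sup (coherent_indep_moments R k).
Proof.
apply/eqP; rewrite eq_le; apply/andP; split.
  apply: le_ereal_sup => _ [f0 /STEP_extend[f [fd f01 ff fE]] <-].
  have [<- <-] := eq_ferrer fE.
  rewrite ferrer_moment//.
  have [X [Y [XE YE cXY iXY]]] := ferrer_coherent fd f01.
  exists _, _, _, X, Y; split => //.
  rewrite unlock XE YE.
  rewrite (fubini_tonelli1 (fun z : measurableTypeR R * measurableTypeR R =>
    (`|f z.1 - conjugate f z.2| ^+ k)%:E))//.
  apply/measurable_EFinP/measurable_funX; apply: measurableT_comp => //.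
  have mf : measurable_fun setT f by exact: nonincreasing_measurable.
  apply: measurable_funB; first exact: measurableT_comp.
  by apply: measurableT_comp => //; exact: measurable_conjugate.
apply: ge_ereal_sup => _ [d [T [P [X [Y [[A [G [H [mA sG sH cX cY]]]] iXY ->]]]]]].
(* The exponent takes the form [k.+2] of the tangent inequality. *)
case: k hk => [|[|k]]// hk.
(* Binning is not exact, so the bound is proved up to an arbitrary positive [e]. *)
apply/lee_addgt0Pr => e e0.
have [N [N0 Ne]] : exists N, (0 < N)%N /\ k.+2%:R * (2 / N%:R) <= e.
  have h0 : 0 <= k.+2%:R * 2 / e by rewrite divr_ge0// ltW.
  exists (Num.bound (k.+2%:R * 2 / e)).
  have := archi_boundP h0; move: (Num.bound _) => N hN.
  have N0 : 0 < N%:R :> R by exact: le_lt_trans hN.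
  split; first by rewrite ltr0n in N0.
  by rewrite mulrA ler_pdivrMr// [leRHS]mulrC -ler_pdivrMr// ltW.
have [x [x01 xd x0 xa xb]] := bin_average N0 mA cX.
have [y [y01 yd y0 ya yb]] := bin_average N0 mA cY.
have X0 := cond_prob_ge0 cX; have X1 := cond_prob_le1 mA cX.
have Y0 := cond_prob_ge0 cY; have Y1 := cond_prob_le1 mA cY.
rewrite unlock (le_trans (moment_le_bins iXY _ N0 X0 X1 Y0 Y1 x01 y01 xb yb))//.
rewrite EFinD leeD ?lee_fin//.
pose p i := fine (P (X @^-1` bin N i)).
pose q j := fine (P (Y @^-1` bin N j)).
(* Independence enters only through this matrix: the mass of a whole cell is [p i * q j], which
   bounds the mass of [A] in it. *)
pose a i j := fine (P (A `&` X @^-1` bin N i `&` Y @^-1` bin N j)).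
have mbX i : measurable (X @^-1` bin N i).
  by apply: measurable_RV; exact: measurable_bin.
have mbY j : measurable (Y @^-1` bin N j).
  by apply: measurable_RV; exact: measurable_bin.
have p0 i : 0 <= p i by exact: fine_ge0.
have q0 j : 0 <= q j by exact: fine_ge0.
have p1 : cum p N.+1 = 1 by exact: sum_binsT.
have q1 : cum q N.+1 = 1 by exact: sum_binsT.
have a01 i j : 0 <= a i j <= p i * q j.
  rewrite /p /q -(independent_fine iXY); [|exact: measurable_bin..].
  have mXY : measurable (X @^-1` bin N i `&` Y @^-1` bin N j) by exact: measurableI.
  rewrite /a -setIA fine_ge0//= fine_le ?fin_num_measure//; first exact: measurableI.
  exact: measureIr.
have ax i : (i < N.+1)%N -> \sum_(j < N.+1) a i j = p i * x i.
  by move=> iN; rewrite -xa// -(sum_bins N0 _ Y0 Y1)//; exact: measurableI.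
have ay j : (j < N.+1)%N -> \sum_(i < N.+1) a i j = q j * y j.
  move=> jN; rewrite -ya// -(sum_bins N0 _ X0 X1)//; last exact: measurableI.
  by apply: eq_bigr => i _; rewrite /a setIAC.
have [f [fd f01 ff fle]] :=
  staircase_moment_ge k p0 p1 x01 xd x0 q0 q1 (fun j _ => yd j) a01 ax ay.
apply: (le_trans fle); apply: ereal_sup_ubound.
exists f; last by rewrite -ferrer_moment// unlock.
split.
- by move=> u _; rewrite in_itv/=; exact: f01.
- by move=> u v _ _; exact: fd.
- by apply: sub_finite_set ff => _ [u _ <-]; exists u.
Qed.
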